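(* For every $N\ge1$, the Okada monoid $\mathsf{O}_N$ is aperiodic, i.e. there exists an integer $K$ such that $\mathbf{e}^K=\mathbf{e}^{K+1}$ for all $\mathbf{e}\in\mathsf{O}_N$. Equivalently, all the groups contained in $\mathsf{O}_N$ (subsemigroups which are groups) are trivial.
   Context: The Okada monoid $\mathsf{O}_N$ is the monoid generated by $\mathsf{E}_1,\dots,\mathsf{E}_{N-1}$ with the relations $\mathsf{E}_i^2=\mathsf{E}_i$ for $1\le i\le N-1$; $\mathsf{E}_i\mathsf{E}_j=\mathsf{E}_j\mathsf{E}_i$ for $|i-j|\ge2$; $\mathsf{E}_{i+1}\mathsf{E}_i\mathsf{E}_{i+1}=\mathsf{E}_{i+1}$ for $1\le i\le N-2$. *)

(* Defs.v *)
From HB Require Import structures.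
From mathcomp Require Import all_boot.
From mathcomp Require Import boolp classical_sets.

Set Implicit Arguments.
Unset Strict Implicit.
Unset Printing Implicit Defensive.

Local Open Scope quotient_scope.
Local Open Scope group_scope.

(* The monoid < A | r > is the quotient of the free monoid seq A (words under
   concatenation) by the smallest congruence containing r. *)
Section Presentation.
Variables (A : choiceType) (r : seq A -> seq A -> Prop).

Inductive congruence_closure : seq A -> seq A -> Prop :=
| congr_rel u v : r u v -> congruence_closure u v
| congr_refl u : congruence_closure u u
| congr_sym u v : congruence_closure u v -> congruence_closure v u
| congr_trans v u w :
    congruence_closure u v -> congruence_closure v w -> congruence_closure u w
| congr_cat u u' v v' :
    congruence_closure u u' -> congruence_closure v v' ->
    congruence_closure (u ++ v) (u' ++ v').

Definition congruenceb (u v : seq A) : bool := `[< congruence_closure u v >].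

Lemma congruenceb_refl : reflexive congruenceb.
Proof. by move=> u; apply/asboolP; exact: congr_refl. Qed.

Lemma congruenceb_sym : symmetric congruenceb.
Proof. by move=> u v; apply/asboolP/asboolP; exact: congr_sym. Qed.

Lemma congruenceb_trans : transitive congruenceb.
Proof.
by move=> v u w /asboolP uv /asboolP vw; apply/asboolP; exact: congr_trans vw.
Qed.

Canonical congruence_equiv :=
  EquivRel congruenceb congruenceb_refl congruenceb_sym congruenceb_trans.

Definition presented_monoid := {eq_quot congruence_equiv}.

HB.instance Definition _ := Choice.on presented_monoid.

Definition presented_pi (u : seq A) : presented_monoid :=
  \pi_({eq_quot congruence_equiv}) u.

Definition presented_repr (x : presented_monoid) : seq A :=
  repr (x : {eq_quot congruence_equiv}).

Lemma presented_reprK : cancel presented_repr presented_pi.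
Proof. exact: reprK. Qed.

Lemma presented_eqP (u v : seq A) :
  presented_pi u = presented_pi v <-> congruence_closure u v.
Proof.
split=> [/eqmodP/asboolP // | uv].
by apply/eqmodP/asboolP.
Qed.

Definition presented_one : presented_monoid := presented_pi [::].

Definition presented_mul (x y : presented_monoid) : presented_monoid :=
  presented_pi (presented_repr x ++ presented_repr y).

Lemma presented_mul_pi (u v : seq A) :
  presented_mul (presented_pi u) (presented_pi v) = presented_pi (u ++ v).
Proof.
by apply/presented_eqP/congr_cat; apply/presented_eqP; rewrite presented_reprK.
Qed.

Lemma presented_mulA : associative presented_mul.
Proof.
move=> x y z; rewrite -[x]presented_reprK -[y]presented_reprK.
by rewrite -[z]presented_reprK !presented_mul_pi catA.
Qed.

Lemma presented_1mul : left_id presented_one presented_mul.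
Proof. by move=> x; rewrite -[x]presented_reprK presented_mul_pi. Qed.

Lemma presented_mul1 : right_id presented_one presented_mul.
Proof. by move=> x; rewrite -[x]presented_reprK presented_mul_pi cats0. Qed.

HB.instance Definition _ :=
  isMonoid.Build presented_monoid presented_mulA presented_1mul presented_mul1.

End Presentation.

(* Generators are indexed from 0: the letter i : 'I_N.-1 stands for E_(i+1). *)
Inductive okada_rel (N : nat) : seq 'I_N.-1 -> seq 'I_N.-1 -> Prop :=
| okada_idem (i : 'I_N.-1) : okada_rel [:: i; i] [:: i]
| okada_comm (i j : 'I_N.-1) :
    (i.+2 <= j) || (j.+2 <= i) -> okada_rel [:: i; j] [:: j; i]
| okada_contract (i j : 'I_N.-1) :
    j = i.+1 :> nat -> okada_rel [:: j; i; j] [:: j].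

Definition okada_monoid (N : nat) : monoidType :=
  presented_monoid (@okada_rel N).

Definition okada_gen (N : nat) (i : 'I_N.-1) : okada_monoid N :=
  presented_pi (@okada_rel N) [:: i].

Definition aperiodic (M : monoidType) : Prop :=
  exists K : nat, forall e : M, e ^+ K = e ^+ K.+1.

Definition subsemigroup (M : semigroupType) (G : set M) : Prop :=
  (exists x, G x) /\ (forall x y, G x -> G y -> G (x * y)).

(* The unit of G need not be the unit of the ambient monoid. *)
Definition group_in (M : semigroupType) (G : set M) : Prop :=
  subsemigroup G /\
  exists2 e, G e &
    (forall x, G x -> e * x = x /\ x * e = x) /\
    (forall x, G x -> exists2 y, G y & x * y = e /\ y * x = e).

(* Main.v *)
Require Import Defs.
From mathcomp Require Import all_boot.
From mathcomp Require Import boolp classical_sets.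

(* Write O_k for the submonoid generated by the first k generators. The last
   relation lets one merge two occurrences of the top generator E of O_(k+1), so
   E a E = c E for every a in O_k, with c in O_(k-1) commuting with E. Hence
   every element of O_(k+1) outside O_k has the form a E b with a, b in O_k, and
   its powers are (a E b)^(n+1) = a c^n E b, where c comes from E (b a) E.
   Aperiodicity of O_(k+1) thus follows from that of O_k. *)

Local Open Scope group_scope.

Lemma expg_sandwich (M : monoidType) (a b c f : M) n :
  f * (b * a) * f = c * f -> (a * f * b) ^+ n.+1 = a * c ^+ n * f * b.
Proof.
move=> /(congr1 ( *%g^~ b)); rewrite -!mulgA => bac.
elim: n => [|n IHn]; first by rewrite expg1 expg0 mul1g.
by rewrite expgSr IHn expgSr -!mulgA bac.
Qed.

Section OkadaMonoid.

Context {N : nat}.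

Local Notation E := (@okada_gen N).

Lemma okada_genK (i : 'I_N.-1) : E i * E i = E i.
Proof.
by rewrite [LHS]presented_mul_pi; apply/presented_eqP/congr_rel/okada_idem.
Qed.

Lemma okada_gen_commute (i j : 'I_N.-1) : i.+2 <= j -> commute (E i) (E j).
Proof.
move=> ij; rewrite /commute [LHS]presented_mul_pi [RHS]presented_mul_pi.
by apply/presented_eqP/congr_rel/okada_comm; rewrite ij.
Qed.

Lemma okada_gen_contract (i j : 'I_N.-1) :
  j = i.+1 :> nat -> E j * E i * E j = E j.
Proof.
move=> ji; rewrite [X in X * _]presented_mul_pi [LHS]presented_mul_pi.
by apply/presented_eqP/congr_rel/okada_contract.
Qed.

(** Words grow by one letter on the left, so induction always exposes the leftmost generator. *)
Inductive okada_prefix (k : nat) : okada_monoid N -> Prop :=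
| okada_prefix1 : okada_prefix k 1
| okada_prefix_cons (i : 'I_N.-1) x :
    i < k -> okada_prefix k x -> okada_prefix k (E i * x).

Lemma okada_prefix_mul k x y :
  okada_prefix k x -> okada_prefix k y -> okada_prefix k (x * y).
Proof.
move=> kx ky; elim: kx => [|i z ik _ kzy]; first by rewrite mul1g.
by rewrite -mulgA; apply: okada_prefix_cons.
Qed.

Lemma okada_prefix_le k l x :
  k <= l -> okada_prefix k x -> okada_prefix l x.
Proof.
move=> kl; elim=> [|i z ik _ lz]; first exact: okada_prefix1.
by apply: okada_prefix_cons lz; apply: leq_trans kl.
Qed.

Lemma okada_prefix0 x : okada_prefix 0 x -> x = 1.
Proof. by case. Qed.

Lemma okada_prefix_full x : okada_prefix N.-1 x.
Proof.
rewrite -[x]presented_reprK; elim: (presented_repr x) => [|i u IHu].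
  exact: okada_prefix1.
by rewrite -cat1s -presented_mul_pi; apply: okada_prefix_cons.
Qed.

Lemma okada_prefix_commute (i : 'I_N.-1) x :
  okada_prefix i.-1 x -> commute x (E i).
Proof.
elim=> [|j z ji _ cz]; first exact/commute_sym/commute1.
apply/commute_sym/commuteM; last exact: commute_sym.
(* For [i = 0] the bound [j < i.-1] is absurd; otherwise it says [j.+2 <= i]. *)
by apply/commute_sym/okada_gen_commute; case: (val i) ji.
Qed.

(** [k] ranges over all naturals, so the top letter is some [i] with value [k]; past the last
    generator only the first case is possible. *)
Definition okada_split (k : nat) (x : okada_monoid N) : Prop :=
  okada_prefix k x \/
  exists (i : 'I_N.-1) (a b : okada_monoid N),
    [/\ i = k :> nat, okada_prefix k a, okada_prefix k b & x = a * E i * b].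

(** Merging at level [i] needs splitting one level below, which itself needs merging there. Taking
    the splitting as a hypothesis unties this mutual recursion. *)
Lemma okada_sandwich_of_split (i : 'I_N.-1) x :
  (forall k y, i = k.+1 :> nat -> okada_prefix k.+1 y -> okada_split k y) ->
  okada_prefix i x ->
  exists2 c, okada_prefix i.-1 c & E i * x * E i = c * E i.
Proof.
case Ei: (nat_of_ord i) => [|k] sp ix.
  exists 1; first exact: okada_prefix1.
  by rewrite (okada_prefix0 _ ix) mulg1 mul1g okada_genK.
have comm z : okada_prefix k z -> E i * z = z * E i.
  by move=> kz; apply/commute_sym/okada_prefix_commute; rewrite Ei.
case: (sp k x erefl ix) => [kx|[j [a [b [jk ka kb ->]]]]].
  by exists x => //; rewrite comm // -mulgA okada_genK.
(* Both [a] and [b] commute with [E i], which can thus be moved next to [E j] on either side, where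
   [E i * E j * E i] contracts. *)
exists (a * b); first exact: okada_prefix_mul.
rewrite -!mulgA -(comm b) // (mulgA _ a) (comm a) // -(mulgA a); congr (a * _).
by rewrite !mulgA okada_gen_contract ?jk.
Qed.

Lemma okada_split_step k :
  (forall l y, k = l.+1 -> okada_prefix l.+1 y -> okada_split l y) ->
  forall x, okada_prefix k.+1 x -> okada_split k x.
Proof.
move=> sp x; elim=> [|i z]; first by left; exact: okada_prefix1.
rewrite ltnS leq_eqVlt => /orP[/eqP ik|ik] _ [kz|[j [a [b [jk ka kb ->]]]]].
- by right; exists i, 1, z; split=> //; [exact: okada_prefix1|rewrite mul1g].
(* A second top generator appears on the left: [E i * a * E i] merges into [c * E i]. *)
- have ij : i = j by apply: val_inj; rewrite /= ik jk.
  have [||c ic aE] := okada_sandwich_of_split i a; rewrite ?ik //.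
  right; exists i, c, b; split=> //.
    by apply: okada_prefix_le ic; rewrite ik leq_pred.
  by rewrite -ij !mulgA aE.
- by left; apply: okada_prefix_cons.
- right; exists j, (E i * a), b; split=> //; first exact: okada_prefix_cons.
  by rewrite !mulgA.
Qed.

Lemma okada_prefix_split k x : okada_prefix k.+1 x -> okada_split k x.
Proof.
elim: k x => [|k IHk] x; apply: okada_split_step => // l y [<-]; exact: IHk.
Qed.

Lemma okada_sandwich (i : 'I_N.-1) x :
  okada_prefix i x ->
  exists2 c, okada_prefix i.-1 c & E i * x * E i = c * E i.
Proof.
by apply: okada_sandwich_of_split => k y _; apply: okada_prefix_split.
Qed.

(** The exponent grows by one per level, since the power [n.+1] of the sandwich involves only
    [c ^+ n]. *)
Lemma okada_prefix_expg k x : okada_prefix k x -> x ^+ k = x ^+ k.+1.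
Proof.
elim: k x => [|k IHk] x kx; first by rewrite (okada_prefix0 _ kx) !expg1n.
case: (okada_prefix_split _ _ kx) => [/IHk xk|[i [a [b [ik ka kb ->]]]]].
  by rewrite expgSr (expgSr x k.+1) -xk.
have [|c ic bac] := okada_sandwich i (b * a).
  by rewrite ik; apply: okada_prefix_mul.
rewrite !(expg_sandwich _ _ _ _ _ _ bac) // IHk //.
by apply: okada_prefix_le ic; rewrite ik leq_pred.
Qed.

End OkadaMonoid.

Lemma expg_cancel_in_group (M : monoidType) (e x y : M) K :
  e * x = x -> y * x = e -> x ^+ K = x ^+ K.+1 -> x = e.
Proof.
move=> ex yx xK.
(* The factor [e] makes the descent on [K] end correctly: [x ^+ 0] is the unit of [M], which may
   differ from [e]. Left multiplication by [y] cancels one [x] at each step. *)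
have: e * x ^+ K = e * x ^+ K.+1 by rewrite -xK.
elim: K {xK} => [|K IHK]; first by rewrite expg0 expg1 mulg1 ex.
rewrite (expgS x K.+1) (expgS x K) !(mulgA e) ex => /(congr1 ( *%g y)).
by rewrite !(mulgA y) yx -expgS; exact: IHK.
Qed.

Lemma aperiodic_group_in (M : monoidType) (G : set M) :
  aperiodic M -> group_in G -> exists e : M, G = [set e]%classic.
Proof.
move=> [K MK] [_ [e Ge [eG invG]]]; exists e.
apply/seteqP; split=> [x Gx|_ ->] //=.
have [[ex _] [y _ [_ yx]]] := (eG x Gx, invG x Gx).
exact: (expg_cancel_in_group _ _ _ y K ex yx (MK x)).
Qed.

Theorem theorem5p10 (N : nat) (hN : 1 <= N) :
  aperiodic (okada_monoid N) /\
  (forall G : set (okada_monoid N), group_in G ->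
     exists e : okada_monoid N, G = [set e]%classic).
Proof.
have ON : aperiodic (okada_monoid N).
  by exists N.-1 => x; apply/okada_prefix_expg/okada_prefix_full.
by split=> // G; apply: aperiodic_group_in.
Qed.
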